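(* Let $N\in\{4,5,6,7,9,10,12\}$, let $\alpha\in\mathbb{Z}$ be an admissible parameter, and let $E_N$ be the (integral) Tate normal form with parameter $\alpha$, on which $P=(0,0)$ is a torsion point of order $N$ (see context). Let $H_n=\omega_n(P)$, $n\ge0$, be the sequence of numerators of the $y$-coordinates of the multiples of $P$. Put $\eta=\alpha^2-\alpha+1$, $\zeta=-\alpha^2+3\alpha-1$, $\lambda=(3\alpha^2-3\alpha+1)(\alpha-2\alpha^2)$, $\theta=2\alpha-2\alpha^2-1$. Then for all $n\ge0$: 1. $N=4$ ($\alpha\ne0$): $H_n=0$ if $n\equiv1,2\ (4)$; otherwise $H_n=\varepsilon\alpha^{(9n^2-a)/8}$, where $\varepsilon=+1$ if $n\equiv0$, $-1$ if $n\equiv3,4,7\ (8)$; $a=0$ if $n\equiv0$, $1$ if $n\equiv3\ (4)$. 2. $N=5$ ($\alpha\ne0$): $H_n=0$ if $n\equiv1,3\ (5)$; otherwise $H_n=\varepsilon\alpha^{(6n^2-a)/5}$, where $\varepsilon=+1$ if $n\equiv0,4,7$, $-1$ if $n\equiv2,5,9\ (10)$; $a=0,-1,1$ according as $n\equiv0,2,4\ (5)$. 3. $N=6$ ($\alpha\ne-1,0$): $H_n=0$ if $n\equiv1,4\ (6)$; otherwise $H_n=\varepsilon\alpha^{(5n^2-a)/4}(\alpha+1)^{n^2}$, where $\varepsilon=+1$ if $n\equiv0,5,6,9$, $-1$ if $n\equiv2,3,8,11\ (12)$; $a=0$ if $n\equiv0,2$, $1$ if $n\equiv3,5\ (6)$.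 4. $N=7$ ($\alpha\ne0,1$): $H_n=0$ if $n\equiv1,5\ (7)$; otherwise $H_n=\varepsilon\alpha^{(15n^2-a)/7}(\alpha-1)^{(9n^2-b)/7}$, where $\varepsilon=+1$ if $n\equiv0,4,7,11$, $-1$ if $n\equiv2,3,6,9,10,13\ (14)$; $a=0,-3,2,-5,1$ and $b=0,1,4,4,2$ according as $n\equiv0,2,3,4,6\ (7)$. 5. $N=9$ ($\alpha\ne0,1$): $H_n=0$ if $n\equiv1,7\ (9)$; otherwise $H_n=\varepsilon\alpha^{(7n^2+a)/3}(\alpha-1)^{(4n^2-b)/3}\eta^{n^2+c}$, where $\varepsilon=+1$ if $n\equiv0,4,5,8,11,12,15$, $-1$ if $n\equiv2,3,6,9,13,14,17\ (18)$; $a=0$ if $n\equiv0,3$, $2$ if $n\equiv2,5$, $-1$ if $n\equiv4,8$, $3$ if $n\equiv6\ (9)$; $b=0$ if $n\equiv0$, $1$ if $n\equiv2,8$, $3$ if $n\equiv3,6$, $4$ if $n\equiv4,5\ (9)$; $c=1$ if $n\equiv4\ (9)$, $0$ otherwise. 6. $N=10$ ($\alpha\ne0,1$): $H_n=0$ if $n\equiv1,8\ (10)$; otherwise $H_n=\varepsilon\alpha^{(63n^2+a)/20}(\alpha-1)^{(27n^2-b)/20}(2\alpha-1)^{(6n^2+c)/5}\zeta^{(15n^2+d)/4}$, where $\varepsilon=+1$ if $n\equiv0,4,5,9,10,13,14,17$, $-1$ if $n\equiv2,3,6,7,12,15,16,19\ (20)$; $a=0,8,-7,32,25,-8,13,-3$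 and $b=0,8,23,32,35,32,23,7$ according as $n\equiv0,2,3,4,5,6,7,9\ (10)$; $c=0$ if $n\equiv0,5$, $1$ if $n\equiv2,3,7$, $-1$ if $n\equiv4,9$, $4$ if $n\equiv6\ (10)$; $d=0$ if $n\equiv0,2,4,6\ (10)$, $1$ otherwise. 7. $N=12$ ($\alpha\neq0,1$): $H_n=0$ if $n\equiv1,10\ (12)$; otherwise $H_n=\varepsilon\alpha^{(n^2-a)/4}(\alpha-1)^{(59n^2+b)/8}(2\alpha-1)^{(n^2-c)/8}\lambda^{(9n^2-d)/8}\theta^{n^2+e}$, where $\varepsilon=+1$ if $n\equiv0,3,5,7,8,11,14,16,18,21$, $-1$ if $n\equiv2,4,6,9,12,15,17,19,20,23\ (24)$; $a=0$ if $n\equiv0$, $4$ if $n\equiv2$, $5$ if $n\equiv3$, $8$ if $n\equiv4,8$, $13$ if $n\equiv5$, $12$ if $n\equiv6$, $9$ if $n\equiv7,9$, $1$ if $n\equiv11\ (12)$; $b=0$ if $n\equiv0,4$, $-4$ if $n\equiv2$, $13$ if $n\equiv3$, $5$ if $n\equiv5,11$, $12$ if $n\equiv6$, $-3$ if $n\equiv7,9$, $16$ if $n\equiv8\ (12)$; $c=0$ if $n\equiv0,4,8$, $4$ if $n\equiv2,6$, $1$ if $n\equiv3,11$, $9$ if $n\equiv5,9$, $-7$ if $n\equiv7\ (12)$; $d=0$ if $n\equiv0,4,8$, $-4$ if $n\equiv2,6$, $1$ if $n\equiv3,7,11$, $-7$ if $n\equiv5,9\ (12)$; $e=1$ if $n\equiv4,7\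 (12)$, $0$ otherwise.
   Context: $n\equiv r\ (N)$ means congruence modulo $N$. The curves $E_N$. For $N=4,5,6,7,9$, $E_N:\ y^2+(1-c)xy-by=x^3-bx^2$ with: $N=4$: $b=\alpha$, $c=0$; $N=5$: $b=c=\alpha$; $N=6$: $b=\alpha+\alpha^2$, $c=\alpha$; $N=7$: $b=\alpha^3-\alpha^2$, $c=\alpha^2-\alpha$; $N=9$: $c=\alpha^2(\alpha-1)$, $b=c(\alpha(\alpha-1)+1)$. (Here $b,c$ are unrelated to the exponents in the claim.) For $N=10,12$ an integral model is used: with $\beta=(2\alpha-1)(\alpha-1)$ and $\zeta,\lambda,\theta$ as in the claim, $E_{10}:\ y^2+(\zeta^2-\alpha\beta\zeta)xy-\alpha^3\beta\zeta^4y=x^3-\alpha^3\beta\zeta^2x^2$, $E_{12}:\ y^2+(\alpha-1)((\alpha-1)^3-\lambda)xy-(\alpha-1)^8\lambda\theta y=x^3-(\alpha-1)^4\lambda\theta x^2$. Admissible integers $\alpha$: $\alpha\ne0$ for $N=4,5$; $\alpha\neq-1,0$ for $N=6$; $\alpha\ne0,1$ for $N=7,9,10,12$. Division polynomials. For an elliptic curve $y^{2}+a_{1}xy+a_{3}y=x^{3}+a_{2}x^{2}+a_{4}x+a_{6}$ put $b_2=a_1^2+4a_2$, $b_4=2a_4+a_1a_3$, $b_6=a_3^2+4a_6$, $b_8=a_1^2a_6+4a_2a_6-a_1a_3a_4+a_2a_3^2-a_4^2$. Define $\psi_0=0$, $\psi_1=1$, $\psi_2=2y+a_1x+a_3$,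 $\psi_3=3x^4+b_2x^3+3b_4x^2+3b_6x+b_8$, $\psi_4=\psi_2\,(2x^6+b_2x^5+5b_4x^4+10b_6x^3+10b_8x^2+(b_2b_8-b_4b_6)x+(b_4b_8-b_6^2))$, and $\psi_{2n+1}=\psi_{n+2}\psi_n^3-\psi_{n-1}\psi_{n+1}^3$ $(n\ge2)$, $\psi_{2n}\psi_2=\psi_{n-1}^2\psi_n\psi_{n+2}-\psi_{n-2}\psi_n\psi_{n+1}^2$ $(n\ge3)$. Further $\phi_0=1$, $\phi_1=x$, $\omega_0=1$, $\omega_1=y$, and for $n\ge2$: $\phi_n=x\psi_n^2-\psi_{n+1}\psi_{n-1}$, $\omega_n=\bigl(\psi_{n-1}^2\psi_{n+2}-\psi_{n-2}\psi_{n+1}^2-\psi_2\psi_n(a_1\phi_n+a_3\psi_n^2)\bigr)/(2\psi_2)$. If $\psi_n(P)\ne0$ then $[n]P=(\phi_n(P)/\psi_n(P)^2,\ \omega_n(P)/\psi_n(P)^3)$. *)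

(* Defs.v *)
From mathcomp Require Import all_boot all_order all_algebra.
From mathcomp Require Import zify ring.
Set Implicit Arguments.
Unset Strict Implicit.
Unset Printing Implicit Defensive.
Import GRing.Theory.
Local Open Scope ring_scope.

(* y^2 + a1 x y + a3 y = x^3 + a2 x^2 + a4 x + a6 *)
Record weierstrass (F : Type) := Weierstrass {
  wa1 : F; wa2 : F; wa3 : F; wa4 : F; wa6 : F }.

(* Polynomials in x and y are elements of {poly {poly F}} with y as the outer
   variable, because 2y + a1 x + a3 then has a unit as leading coefficient when
   2 != 0 in F, so that %/ by a multiple of it is genuine Euclidean division.
   Nothing is reduced modulo the equation of the curve: all the divisions below
   are already exact in F[x, y] (psi_even and omega_spec), and reduction would
   not change the values at points of the curve. *)
Section DivisionPolynomials.
Variables (F : fieldType) (E : weierstrass F).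

Let cst (c : F) : {poly {poly F}} := c%:P%:P.
Let X : {poly {poly F}} := 'X%:P.
Let Y : {poly {poly F}} := 'X.

Let a1 := wa1 E. Let a2 := wa2 E. Let a3 := wa3 E.
Let a4 := wa4 E. Let a6 := wa6 E.

Definition wb2 : F := a1 ^+ 2 + 4 * a2.
Definition wb4 : F := 2 * a4 + a1 * a3.
Definition wb6 : F := a3 ^+ 2 + 4 * a6.
Definition wb8 : F :=
  a1 ^+ 2 * a6 + 4 * a2 * a6 - a1 * a3 * a4 + a2 * a3 ^+ 2 - a4 ^+ 2.

Definition psi2 : {poly {poly F}} := 2 * Y + cst a1 * X + cst a3.

Definition psi3 : {poly {poly F}} :=
  3 * X ^+ 4 + cst wb2 * X ^+ 3 + 3 * cst wb4 * X ^+ 2 + 3 * cst wb6 * X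
  + cst wb8.

Definition psi4 : {poly {poly F}} :=
  psi2 * (2 * X ^+ 6 + cst wb2 * X ^+ 5 + 5 * cst wb4 * X ^+ 4
          + 10 * cst wb6 * X ^+ 3 + 10 * cst wb8 * X ^+ 2
          + cst (wb2 * wb8 - wb4 * wb6) * X + cst (wb4 * wb8 - wb6 ^+ 2)).

(* psi_rec k n is psi_n as soon as n < k; k only bounds the recursion depth. *)
Fixpoint psi_rec (k n : nat) : {poly {poly F}} :=
  if k is k'.+1 then
    let p := psi_rec k' in
    match n with
    | 0 => 0
    | 1 => 1
    | 2 => psi2
    | 3 => psi3
    | 4 => psi4
    | _ =>
      let m := n./2 in
      if odd n then p m.+2 * p m ^+ 3 - p m.-1 * p m.+1 ^+ 3
      else (p m.-1 ^+ 2 * p m * p m.+2 - p m.-2 * p m * p m.+1 ^+ 2) %/ psi2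
    end
  else 0.

Definition psi (n : nat) : {poly {poly F}} := psi_rec n.+1 n.

Definition phi (n : nat) : {poly {poly F}} :=
  match n with
  | 0 => 1
  | 1 => X
  | _ => X * psi n ^+ 2 - psi n.+1 * psi n.-1
  end.

Definition omega_num (n : nat) : {poly {poly F}} :=
  psi n.-1 ^+ 2 * psi n.+2 - psi n.-2 * psi n.+1 ^+ 2
  - psi2 * psi n * (cst a1 * phi n + cst a3 * psi n ^+ 2).

Definition omega (n : nat) : {poly {poly F}} :=
  match n with
  | 0 => 1
  | 1 => Y
  | _ => omega_num n %/ (2 * psi2)
  end.

Let psi_recS (k n : nat) : (5 <= n)%N ->
  psi_rec k.+1 n =
    if odd n then psi_rec k (n./2).+2 * psi_rec k n./2 ^+ 3
                  - psi_rec k (n./2).-1 * psi_rec k (n./2).+1 ^+ 3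
    else (psi_rec k (n./2).-1 ^+ 2 * psi_rec k n./2 * psi_rec k (n./2).+2
          - psi_rec k (n./2).-2 * psi_rec k n./2 * psi_rec k (n./2).+1 ^+ 2)
         %/ psi2.
Proof. by case: n => [|[|[|[|[|n]]]]]. Qed.

Let psi_rec_eq (k1 k2 n : nat) :
  (n < k1)%N -> (n < k2)%N -> psi_rec k1 n = psi_rec k2 n.
Proof.
elim: k1 k2 n => [|k1 IH] [|k2] // n lt1 lt2.
case: (ltnP n 5) => [lt5|ge5].
  by move: n lt5 {lt1 lt2} => [|[|[|[|[|n]]]]].
have e i : (i < n)%N -> psi_rec k1 i = psi_rec k2 i.
  by move=> lt_i; apply: IH; lia.
by rewrite !psi_recS //; case: ifP => odd_n; rewrite !e //; lia.
Qed.

Lemma psi_rec_psi (k n : nat) : (n < k)%N -> psi_rec k n = psi n.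
Proof. by move=> lt_nk; apply: psi_rec_eq. Qed.

Lemma psi_odd (n : nat) : (2 <= n)%N ->
  psi n.*2.+1 = psi n.+2 * psi n ^+ 3 - psi n.-1 * psi n.+1 ^+ 3.
Proof.
move=> ge2; rewrite {1}/psi psi_recS; last by lia.
rewrite ifT; last by lia.
have -> : (n.*2.+1)./2 = n by lia.
by rewrite !psi_rec_psi //; lia.
Qed.

Let psi_evenE (n : nat) : (3 <= n)%N ->
  psi n.*2 = (psi n.-1 ^+ 2 * psi n * psi n.+2
              - psi n.-2 * psi n * psi n.+1 ^+ 2) %/ psi2.
Proof.
move=> ge3; rewrite {1}/psi psi_recS; last by lia.
rewrite ifF; last by lia.
have -> : (n.*2)./2 = n by lia.
by rewrite !psi_rec_psi //; lia.
Qed.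

Hypothesis two_neq0 : (2 : F) != 0.

Let lead_psi2 : lead_coef psi2 = 2.
Proof.
have e : psi2 = 2%:P * 'X + (a1 *: 'X + a3%:P)%:P.
  by rewrite /psi2 /cst /X /Y -addrA polyC_natr -mul_polyC polyCD polyCM.
have n0 : (2 : {poly F}) != 0 by rewrite -polyC_natr polyC_eq0.
by rewrite e lead_coefDl ?lead_coefM ?lead_coefC ?lead_coefX ?mulr1 //
     size_Cmul // size_polyX ltnS size_polyC_leq1.
Qed.

Let unit2 : (2 : {poly F}) \is a GRing.unit.
Proof.
by rewrite -polyC_natr poly_unitE size_polyC two_neq0 coefC unitfE two_neq0.
Qed.

Let divpsi2K (q : {poly {poly F}}) : (psi2 * q) %/ psi2 = q.
Proof. by rewrite mulrC Pdiv.IdomainUnit.mulpK // lead_psi2. Qed.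

Let div2psi2K (q : {poly {poly F}}) : (2 * psi2 * q) %/ (2 * psi2) = q.
Proof.
rewrite mulrC Pdiv.IdomainUnit.mulpK // lead_coefM lead_psi2.
by rewrite -polyC_natr lead_coefC unitrM unit2.
Qed.

Let psi_step (n : nat) : (2 <= n)%N ->
    (forall m, (m <= n.+2)%N -> ~~ odd m -> exists q, psi m = psi2 * q) ->
  exists q,
    psi n.-1 ^+ 2 * psi n.+2 - psi n.-2 * psi n.+1 ^+ 2 = psi2 * q /\
    exists r, psi n * q = psi2 * r.
Proof.
move=> ge2 IH; case odd_n: (odd n).
  have [|| q1 ->] := IH n.-1; [lia | lia |].
  have [|| q2 ->] := IH n.+1; [lia | lia |].
  exists (psi2 * (q1 ^+ 2 * psi n.+2 - psi n.-2 * q2 ^+ 2)); split; first by ring.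
  by exists (psi n * (q1 ^+ 2 * psi n.+2 - psi n.-2 * q2 ^+ 2)); ring.
have [|| q0 ->] := IH n; [lia | lia |].
have [|| q1 ->] := IH n.+2; [lia | lia |].
have [|| q2 ->] := IH n.-2; [lia | lia |].
exists (psi n.-1 ^+ 2 * q1 - q2 * psi n.+1 ^+ 2); split; first by ring.
by eexists; rewrite -mulrA.
Qed.

Let psi_even_dvd (n : nat) : ~~ odd n -> exists q, psi n = psi2 * q.
Proof.
elim/ltn_ind: n => n IH even_n; case: (ltnP n 6) => [lt6|ge6].
  move: n lt6 even_n {IH} => [|[|[|[|[|[|n]]]]]] //= _ _.
  - by exists 0; rewrite mulr0.
  - by exists 1; rewrite mulr1.
  - by eexists.
have en : n = n./2.*2 by lia.
have [||q [eq_q [r eq_r]]] := @psi_step n./2; first by lia.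
  by move=> m le_m; apply: IH; lia.
exists r; rewrite {1}en psi_evenE; last by lia.
rewrite -[RHS]divpsi2K -eq_r; congr (_ %/ _).
by rewrite [RHS]mulrCA -eq_q; ring.
Qed.

Lemma psi_even (n : nat) : (3 <= n)%N ->
  psi n.*2 * psi2 = psi n.-1 ^+ 2 * psi n * psi n.+2
                    - psi n.-2 * psi n * psi n.+1 ^+ 2.
Proof.
move=> ge3; have [|m _|q [eq_q _]] := @psi_step n; first by lia.
  exact: psi_even_dvd.
have e : psi n.-1 ^+ 2 * psi n * psi n.+2 - psi n.-2 * psi n * psi n.+1 ^+ 2
         = psi2 * (psi n * q) by rewrite [RHS]mulrCA -eq_q; ring.
by rewrite psi_evenE // e divpsi2K mulrC.
Qed.

Lemma omega_spec (n : nat) : (2 <= n)%N ->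
  2 * psi2 * omega n = omega_num n.
Proof.
move=> ge2; have [|m _|q [eq_q _]] := @psi_step n; first by lia.
  exact: psi_even_dvd.
pose t : {poly {poly F}} := (2^-1)%:P%:P.
have u : 2 * t = 1.
  by rewrite -(polyC_natr {poly F}) -(polyC_natr F) -!polyCM divff.
pose w := q - psi n * (cst a1 * phi n + cst a3 * psi n ^+ 2).
have e : omega_num n = 2 * psi2 * (t * w).
  by rewrite mulrACA u mul1r /omega_num eq_q /w; ring.
have -> : omega n = omega_num n %/ (2 * psi2).
  by move: ge2; case: (n) => [|[|m]].
by rewrite {1}e div2psi2K e.
Qed.

End DivisionPolynomials.

(* p(x, y) for p with y as the outer variable. *)
Definition eval_xy (F : fieldType) (p : {poly {poly F}}) (x y : F) : F :=
  p.[y%:P].[x].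

(* y^2 + (1 - c) x y - b y = x^3 - b x^2 *)
Definition tate (F : fieldType) (b c : F) : weierstrass F :=
  Weierstrass (1 - c) (- b) (- b) 0 0.

Section TateCurves.
Variable alpha : int.

Definition eta : int := alpha ^+ 2 - alpha + 1.
Definition zeta : int := - alpha ^+ 2 + 3 * alpha - 1.
Definition lambda : int :=
  (3 * alpha ^+ 2 - 3 * alpha + 1) * (alpha - 2 * alpha ^+ 2).
Definition theta : int := 2 * alpha - 2 * alpha ^+ 2 - 1.
Definition beta : int := (2 * alpha - 1) * (alpha - 1).

Let a : rat := alpha%:~R.
Let z : rat := zeta%:~R.
Let l : rat := lambda%:~R.
Let t : rat := theta%:~R.
Let be : rat := beta%:~R.

Definition E4 : weierstrass rat := tate a 0.
Definition E5 : weierstrass rat := tate a a.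
Definition E6 : weierstrass rat := tate (a + a ^+ 2) a.
Definition E7 : weierstrass rat := tate (a ^+ 3 - a ^+ 2) (a ^+ 2 - a).
Definition E9 : weierstrass rat :=
  let c := a ^+ 2 * (a - 1) in tate (c * (a * (a - 1) + 1)) c.

(* Integral models, isomorphic over the rationals to a curve tate b c. *)
Definition E10 : weierstrass rat :=
  Weierstrass (z ^+ 2 - a * be * z) (- (a ^+ 3 * be * z ^+ 2))
              (- (a ^+ 3 * be * z ^+ 4)) 0 0.
Definition E12 : weierstrass rat :=
  Weierstrass ((a - 1) * ((a - 1) ^+ 3 - l)) (- ((a - 1) ^+ 4 * l * t))
              (- ((a - 1) ^+ 8 * l * t)) 0 0.

End TateCurves.

(* omega_n at the point P = (0, 0) *)
Definition numer_y (E : weierstrass rat) (n : nat) : rat :=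
  eval_xy (omega E n) 0 0.

(* by_residue m [:: (rs1, v1); (rs2, v2); ...] n is the value v_i for the first
   i such that n is congruent modulo m to an element of rs_i, and 0 if there is
   no such i. *)
Definition by_residue (m : nat) (table : seq (seq nat * int)) (n : nat) : int :=
  head 0 [seq row.2 | row <- table & (n %% m)%N \in row.1].

(* Main.v *)
Require Import Defs.
From mathcomp Require Import all_boot all_order all_algebra.
From mathcomp Require Import zify ring.
Import GRing.Theory.
Set Implicit Arguments.
Unset Strict Implicit.
Unset Printing Implicit Defensive.
Local Open Scope ring_scope.

(** Write v(n) = psi_n(P) and h(n) = omega_n(P) for P = (0, 0). At P the
    recurrences defining the division polynomials become the elliptic
    divisibility sequence relations, which together with v(0), ..., v(4)
    determine v because v(2) = a3 is nonzero (origin_psi, ev_psi); the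
    definition of omega_n then expresses 2 v(2) h(n) through v (numer_y_eq).

    Since P has order N, v is quasi-periodic: there are constants C and D with
    C^N = D^2 and v(n + N) = C^n D v(n). All terms of the recurrence for
    v(2m + 1), and likewise for v(2m) v(2) and for 2 v(2) h(n), are multiplied
    by the same monomial in C and D when m or n moves by N. So a quasi-periodic
    candidate for v satisfies the recurrences as soon as it satisfies them at N
    consecutive indices, and h(n + N) = C^(3n) D^3 h(n) follows
    (numer_y_qseq). No group law is involved.

    On the curves E_N the candidate for v(n), and then h(n), is zero or a
    product of powers of -1 and of a few fixed polynomials in alpha, and so are
    C and D. Each base identity is therefore a relation between three or five
    such products. Their exponents can exceed a thousand, but once the greatest
    common monomial is divided out (lin_comb_cancel) a polynomial identity of
    small degree in alpha is left, which ring decides (certificate4 and its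
    analogues). Finally, h(k N + r) = h(r) C^(3rk) D^(3k^2) has exponents that
    are quadratic in k; in terms of n = k N + r they are the quadratic
    expressions of the theorem. *)

(** * Monomials as exponent vectors *)

(** Exponent vectors refer to a list of bases given separately. Keeping them
    apart from the values of the bases lets exponents be computed with closed
    natural numbers while the bases stay symbolic. *)
Fixpoint add_exp (e f : seq nat) : seq nat :=
  match e, f with
  | i :: e', j :: f' => (i + j)%N :: add_exp e' f'
  | [::], _ => f
  | _, [::] => e
  end.

Definition scale_exp (k : nat) (e : seq nat) : seq nat :=
  [seq (k * i)%N | i <- e].

Fixpoint sub_exp (e f : seq nat) : seq nat :=
  match e, f with
  | i :: e', j :: f' => (i - j)%N :: sub_exp e' f'
  | _, _ => e
  end.

Fixpoint min_exp (e f : seq nat) : seq nat :=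
  match e, f with
  | i :: e', j :: f' => minn i j :: min_exp e' f'
  | _, _ => [::]
  end.

(** None stands for 0, which divides out of no product and must not take part
    in the computation of common factors. *)
Definition mono := option (seq nat).

Definition mulm (M P : mono) : mono :=
  if M is Some e then omap (add_exp e) P else None.
Arguments mulm : simpl never.

Definition expm (M : mono) (k : nat) : mono := omap (scale_exp k) M.

Definition divm (M : mono) (g : seq nat) : mono := omap (sub_exp^~ g) M.

Definition gcdm (s : seq mono) : seq nat :=
  if pmap id s is e :: s' then foldr min_exp e s' else [::].

(** With k = n %/ N and r = n %% N this is the r-th row of W times
    c ^ (r k) d ^ (k^2), the solution of f (n + N) = c ^ n d f n with the rows
    of W as its first N values, provided that c ^ N = d ^ 2. *)
Definition qseq (N : nat) (W : seq mono) (c d : seq nat) (n : nat) : mono :=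
  let k := (n %/ N)%N in let r := (n %% N)%N in
  omap (fun w => add_exp w
          (add_exp (scale_exp (r * k) c) (scale_exp (k * k) d)))
       (nth None W r).

Fixpoint monv (R : comNzRingType) (xs : seq R) (e : seq nat) : R :=
  match xs, e with
  | x :: xs', i :: e' => x ^+ i * monv xs' e'
  | _, _ => 1
  end.

Lemma monv_neq0 (F : fieldType) (xs : seq F) e : 0 \notin xs -> monv xs e != 0.
Proof.
elim: xs e => [|x s IH] [|i e] //=; rewrite ?oner_neq0 //.
rewrite inE negb_or eq_sym => /andP[x0 /IH s0].
by rewrite mulf_neq0 // expf_neq0.
Qed.

Lemma monv_intr (xs : seq int) e :
  monv [seq x%:~R | x <- xs] e = (monv xs e)%:~R :> rat.
Proof.
by elim: xs e => [|x s IH] [|i e] //=; rewrite IH intrM rmorphXn.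
Qed.

Section Values.
Variables (R : comNzRingType) (xs : seq R).

Definition val_mono (M : mono) : R := if M is Some e then monv xs e else 0.

Lemma monv_add e f : monv xs (add_exp e f) = monv xs e * monv xs f.
Proof.
elim: xs e f => [|x s IH] [|i e] [|j f] //=; rewrite ?mulr1 ?mul1r //.
by rewrite IH exprD mulrACA.
Qed.

Lemma monv_scale k e : monv xs (scale_exp k e) = monv xs e ^+ k.
Proof.
elim: xs e => [|x s IH] [|i e] //=; rewrite ?expr1n //.
by rewrite IH exprMn mulnC exprM.
Qed.

Lemma val_mulm M P : val_mono (mulm M P) = val_mono M * val_mono P.
Proof.
case: M P => [e|] [f|] //=; rewrite /mulm /= ?mulr0 ?mul0r //; exact: monv_add.
Qed.

Lemma val_expm M k : (0 < k)%N -> val_mono (expm M k) = val_mono M ^+ k.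
Proof.
by case: M => [e|] /= k0; [exact: monv_scale | rewrite expr0n eqn0Ngt k0].
Qed.

Fixpoint lin_comb (cs : seq R) (Ms : seq mono) : R :=
  match cs, Ms with
  | c :: cs', M :: Ms' => c * val_mono M + lin_comb cs' Ms'
  | _, _ => 0
  end.

(** Dividing by the common monomial keeps the degrees of the remaining
    polynomial identities small. That it divides every term is left as a
    hypothesis, because it is decided by computation in each instance. *)
Lemma lin_comb_cancel (cs : seq R) (Ms : seq mono) :
  let g := gcdm Ms in let Ps := [seq divm M g | M <- Ms] in
  [seq mulm (Some g) P | P <- Ps] == Ms ->
  lin_comb cs Ps = 0 -> lin_comb cs Ms = 0.
Proof.
move=> /=; move: (gcdm Ms) => g /eqP e0 eq0; rewrite -e0.
suff e Ps : lin_comb cs [seq mulm (Some g) P | P <- Ps] =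
            monv xs g * lin_comb cs Ps by rewrite e eq0 mulr0.
elim: cs Ps {e0 eq0} => [|c s IH] [|P Ps] /=; rewrite ?mulr0 //.
by rewrite IH val_mulm /= mulrDr; congr (_ + _); rewrite mulrCA.
Qed.

(** Passing from k to k + 1 multiplies by c ^ r d ^ (2 k + 1), and this is
    c ^ (k N + r) d because c ^ N = d ^ 2. *)
Lemma val_qseq_shift N W c d n : (0 < N)%N ->
    monv xs c ^+ N = monv xs d ^+ 2 ->
  val_mono (qseq N W c d (n + N)) =
    monv xs c ^+ n * monv xs d * val_mono (qseq N W c d n).
Proof.
move=> N0 cd; rewrite /qseq modnDr divnDr // divnn N0 addn1.
case: (nth _ _ _) => [w|] /=; last by rewrite mulr0.
have en : monv xs c ^+ n = monv xs d ^+ (2 * (n %/ N)) * monv xs c ^+ (n %% N).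
  by rewrite {1}(divn_eq n N) exprD mulnC exprM cd -exprM.
rewrite en !monv_add !monv_scale; move: (n %/ N)%N (n %% N)%N => k r.
rewrite mulnS exprD (_ : k.+1 * k.+1 = 2 * k + 1 + k * k)%N; last by lia.
by rewrite !exprD expr1; ring.
Qed.

End Values.

(** The recursion of monv associates products to the right, whereas closed
    forms are usually written with products associated to the left. *)
Lemma monv_left (R : comNzRingType) (x : R) xs i e :
  monv (x :: xs) (i :: e) =
    foldl (fun z p => z * p.1 ^+ p.2) (x ^+ i) (zip xs e).
Proof.
rewrite /=; elim: xs e (x ^+ i) => [|y s IH] [|j e] z /=; rewrite ?mulr1 //.
by rewrite mulrA IH.
Qed.

(** The first base being -1, its exponents matter only modulo 2. *)
Lemma monv_signed (R : comNzRingType) (xs : seq R) N i j c d :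
    ~~ odd (i * N) -> scale_exp N c = scale_exp 2 d ->
  monv (-1 :: xs) (i :: c) ^+ N = monv (-1 :: xs) (j :: d) ^+ 2.
Proof.
move=> even cd; rewrite /= !exprMn -!monv_scale cd -!exprM.
by rewrite -[in LHS]signr_odd -[in RHS]signr_odd (negPf even) oddM andbF.
Qed.

(** * Division polynomials at the origin *)

Section AtOrigin.
Variable E : weierstrass rat.
Let ev (p : {poly {poly rat}}) : rat := eval_xy p 0 0.

Hypotheses (a4_0 : wa4 E = 0) (a6_0 : wa6 E = 0) (a3_neq0 : wa3 E != 0).

Let evM p q : ev (p * q) = ev p * ev q.
Proof. by rewrite /ev /eval_xy !hornerE. Qed.
Let evD p q : ev (p + q) = ev p + ev q.
Proof. by rewrite /ev /eval_xy !hornerE. Qed.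
Let evN p : ev (- p) = - ev p.
Proof. by rewrite /ev /eval_xy !hornerE. Qed.
Let evX p k : ev (p ^+ k) = ev p ^+ k.
Proof. by rewrite /ev /eval_xy !hornerE. Qed.
Let ev_nat k : ev k%:R = k%:R.
Proof. by rewrite /ev /eval_xy -!polyC_natr !hornerE. Qed.
Let ev_cst a : ev a%:P%:P = a.
Proof. by rewrite /ev /eval_xy !hornerE. Qed.
Let ev_x : ev ('X%:P) = 0.
Proof. by rewrite /ev /eval_xy !hornerE. Qed.
Let ev_y : ev 'X = 0.
Proof. by rewrite /ev /eval_xy !hornerE. Qed.
Let evs := (ev_nat, ev_cst, ev_x, ev_y, evX, evM, evN, evD).

(* The coefficients are variables in the next five equations: on the division
   polynomials themselves, rewriting with evs would unfold psi. *)
Let ev_psi3 a b c d :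
  ev (3 * 'X%:P ^+ 4 + a%:P%:P * 'X%:P ^+ 3 + 3 * b%:P%:P * 'X%:P ^+ 2
      + 3 * c%:P%:P * 'X%:P + d%:P%:P) = d.
Proof. by rewrite !evs !expr0n /= !mulr0 !add0r. Qed.
Let ev_psi4 a b c d e f :
  ev (2 * 'X%:P ^+ 6 + a%:P%:P * 'X%:P ^+ 5 + 5 * b%:P%:P * 'X%:P ^+ 4
      + 10 * c%:P%:P * 'X%:P ^+ 3 + 10 * d%:P%:P * 'X%:P ^+ 2
      + e%:P%:P * 'X%:P + f%:P%:P) = f.
Proof. by rewrite !evs !expr0n /= !mulr0 !add0r. Qed.
Let ev_odd p q r s : ev (p * q ^+ 3 - r * s ^+ 3) =
  ev p * ev q ^+ 3 - ev r * ev s ^+ 3.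
Proof. by rewrite !evs. Qed.
Let ev_even p q r s t : ev (p ^+ 2 * q * r - s * q * t ^+ 2) =
  ev p ^+ 2 * ev q * ev r - ev s * ev q * ev t ^+ 2.
Proof. by rewrite !evs. Qed.
Let ev_omega p q r s t u a b :
  ev (p ^+ 2 * q - r * s ^+ 2 - t * u * (a%:P%:P * ('X%:P * u ^+ 2 - s * p) +
        b%:P%:P * u ^+ 2)) =
  ev p ^+ 2 * ev q - ev r * ev s ^+ 2
    - ev t * ev u * (b * ev u ^+ 2 - a * ev s * ev p).
Proof. by rewrite !evs; ring. Qed.

(** The elliptic divisibility sequence of the point (0, 0) on a curve with
    a4 = a6 = 0; the values at 3 and 4 are those of psi3 and psi4 there. *)
Record origin_psi (v : nat -> rat) : Prop := OriginPsi {
  op0 : v 0%N = 0;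
  op1 : v 1%N = 1;
  op2 : v 2 = wa3 E;
  op3 : v 3 = wa2 E * wa3 E ^+ 2;
  op4 : v 4 = wa3 E ^+ 4 * (wa1 E * wa2 E - wa3 E);
  op_odd : forall m, (2 <= m)%N ->
    v m.*2.+1 = v m.+2 * v m ^+ 3 - v m.-1 * v m.+1 ^+ 3;
  op_even : forall m, (3 <= m)%N ->
    v m.*2 * v 2 = v m.-1 ^+ 2 * v m * v m.+2 - v m.-2 * v m * v m.+1 ^+ 2 }.

(** The even recurrence determines v (2m) because v 2 = a3 can be cancelled. *)
Lemma ev_psi v : origin_psi v -> forall n, ev (psi E n) = v n.
Proof.
case=> v0 v1 v2 v3 v4 vo vE; elim/ltn_ind=> n IH.
have e2 : ev (psi2 E) = wa3 E by rewrite /psi2 !evs; ring.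
case: (ltnP n 5) => [|n5].
  move: n {IH} => [|[|[|[|[|]]]]] //= _.
  - by rewrite v0 (ev_nat 0).
  - by rewrite v1 (ev_nat 1).
  - by rewrite v2.
  - by rewrite v3 /psi3 ev_psi3 /wb8 a4_0 a6_0; ring.
  - by rewrite v4 /psi4 evM e2 ev_psi4 /wb8 /wb6 /wb4 a4_0 a6_0; ring.
have n2 : n = n./2.*2.+1 \/ n = n./2.*2 by lia.
case: n2 => en; rewrite en.
  rewrite psi_odd; last by lia.
  rewrite vo; last by lia.
  by rewrite ev_odd !IH //; lia.
apply: (mulIf a3_neq0); rewrite -{2}v2 vE; last by lia.
rewrite -e2 -evM psi_even //; last by lia.
by rewrite ev_even !IH //; lia.
Qed.

Lemma numer_y_eq v : origin_psi v -> forall n, (2 <= n)%N ->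
  2 * v 2 * numer_y E n =
    v n.-1 ^+ 2 * v n.+2 - v n.-2 * v n.+1 ^+ 2
    - v 2 * v n * (wa3 E * v n ^+ 2 - wa1 E * v n.+1 * v n.-1).
Proof.
move=> ov n n2; have psiv := ev_psi ov.
rewrite -(psiv 2) -[2]/(2%:R) -(ev_nat 2) -evM /numer_y -/(ev _) -evM.
rewrite (omega_spec (F := rat)) // /omega_num.
have -> : phi E n = 'X%:P * psi E n ^+ 2 - psi E n.+1 * psi E n.-1.
  by case: n n2 => [|[|n]].
by rewrite -[psi2 E]/(psi E 2) ev_omega !psiv.
Qed.
End AtOrigin.

(** * Quasi-periodic sequences *)

Section Periodic.
Variables (E : weierstrass rat) (bs : seq int) (N : nat) (W U : seq mono)
  (c d : seq nat).

Let xs : seq rat := [seq x%:~R | x <- bs].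
Let P := qseq N W c d.
Let Q := qseq N U (scale_exp 3 c) (scale_exp 3 d).
Let v n := val_mono xs (P n).
Let h n := val_mono xs (Q n).

(** The terms, up to coefficients, of the recurrences for psi_(2m+1) and
    psi_(2m) and of the defining relation of omega_n at (0, 0). The factor a3
    of the latter is represented by f 2. *)
Definition odd_terms (f : nat -> mono) (m : nat) : seq mono :=
  [:: f m.*2.+1; mulm (f m.+2) (expm (f m) 3);
      mulm (f m.-1) (expm (f m.+1) 3)].

Definition even_terms (f : nat -> mono) (m : nat) : seq mono :=
  [:: mulm (f m.*2) (f 2); mulm (expm (f m.-1) 2) (mulm (f m) (f m.+2));
      mulm (f m.-2) (mulm (f m) (expm (f m.+1) 2))].

Definition omega_terms (f g : nat -> mono) (n : nat) : seq mono :=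
  [:: mulm (f 2) (g n); mulm (expm (f n.-1) 2) (f n.+2);
      mulm (f n.-2) (expm (f n.+1) 2); mulm (expm (f 2) 2) (expm (f n) 3);
      mulm (f 2) (mulm (f n) (mulm (f n.+1) (f n.-1)))].

(** A finite computation that determines psi and omega at (0, 0): by
    homogeneity each recurrence is needed only at N consecutive indices, here
    from the first index in its range on. The multipliers of Q are the cubes of
    those of P because the y-coordinate omega_n / psi_n^3 of [n](0, 0) depends
    only on n modulo N. *)
Record omega_certificate : Prop := OmegaCertificate {
  oc_period : (0 < N)%N;
  oc_multipliers : monv xs c ^+ N = monv xs d ^+ 2;
  oc_a4 : wa4 E = 0;
  oc_a6 : wa6 E = 0;
  oc_bases : 0 \notin xs;
  oc_row2 : P 2 != None;
  oc_psi0 : v 0 = 0;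
  oc_psi1 : v 1 = 1;
  oc_psi2 : v 2 = wa3 E;
  oc_psi3 : v 3 = wa2 E * wa3 E ^+ 2;
  oc_psi4 : v 4 = wa3 E ^+ 4 * (wa1 E * wa2 E - wa3 E);
  oc_odd : forall i, (i < N)%N ->
    lin_comb xs [:: 1; -1; 1] (odd_terms P i.+2) = 0;
  oc_even : forall i, (i < N)%N ->
    lin_comb xs [:: 1; -1; 1] (even_terms P i.+3) = 0;
  oc_omega0 : h 0 = 1;
  oc_omega1 : h 1 = 0;
  oc_omega : forall i, (i < N)%N ->
    lin_comb xs [:: 2; -1; 1; 1; - wa1 E] (omega_terms P Q i.+2) = 0 }.

Hypothesis cert : omega_certificate.

Let a3_neq0 : wa3 E != 0.
Proof.
rewrite -(oc_psi2 cert) /v.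
by case: (P 2) (oc_row2 cert) => // e _; apply/monv_neq0/(oc_bases cert).
Qed.

Lemma period_ind (p : nat -> Prop) :
    (forall i, (i < N)%N -> p i) -> (forall i, p i -> p (i + N)%N) ->
  forall i, p i.
Proof.
move=> base step; elim/ltn_ind=> i IH; have N0 := oc_period cert.
have [/base //|Ni] := ltnP i N.
by rewrite -(subnK Ni); apply/step/IH; lia.
Qed.

Let C := monv xs c.
Let D := monv xs d.

Let vS k i : v (k + (i + N)) = C ^+ i * C ^+ k * D * v (k + i).
Proof.
rewrite -exprD addnA /v /P (addnC i).
exact: val_qseq_shift _ _ (oc_period cert) (oc_multipliers cert).
Qed.

Let vS2 k i :
  v (k + (i + N).*2) = (C ^+ i) ^+ 4 * C ^+ k ^+ 2 * D ^+ 4 * v (k + i.*2).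
Proof.
have -> : ((i + N).*2 = i.*2 + N + N)%N by lia.
rewrite !vS exprD (oc_multipliers cert : C ^+ N = D ^+ 2) -muln2 exprM; ring.
Qed.

Let hS k i :
  h (k + (i + N)) = (C ^+ i) ^+ 3 * C ^+ k ^+ 3 * D ^+ 3 * h (k + i).
Proof.
have -> : C ^+ i ^+ 3 * C ^+ k ^+ 3 * D ^+ 3 =
    monv xs (scale_exp 3 c) ^+ (k + i) * monv xs (scale_exp 3 d).
  by rewrite !monv_scale -/C -/D (exprAC C 3 (k + i)) exprD; ring.
rewrite addnA; apply: val_qseq_shift (oc_period cert) _.
by rewrite !monv_scale exprAC (oc_multipliers cert) exprAC.
Qed.

(** Each recurrence is homogeneous under the shift by N: the shift multiplies
    all its terms by the same monomial in C and D. *)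
Lemma origin_psi_qseq : origin_psi E v.
Proof.
case: (cert) => _ _ _ _ _ _ v0 v1 v2 v3 v4 vo ve _ _ _; split => //.
- case=> [|[|m]] // _; elim/period_ind: m => [i /vo|i].
    by rewrite /= !val_mulm !val_expm // => e; apply/eqP; rewrite -subr_eq0 -e
       /v; apply/eqP; ring.
  (* Indices are rewritten as sums k + i, so that vS and vS2 apply. *)
  rewrite -[LHS]/(v (5 + _.*2)) -[RHS]/(v (4 + _) * v (2 + _) ^+ 3 -
    v (1 + _) * v (3 + _) ^+ 3) => e.
  rewrite -[LHS]/(v (5 + _.*2)) -[RHS]/(v (4 + _) * v (2 + _) ^+ 3 -
    v (1 + _) * v (3 + _) ^+ 3) vS2 !vS e; ring.
- case=> [|[|[|m]]] // _; elim/period_ind: m => [i /ve|i].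
    by rewrite /= !val_mulm !val_expm // => e; apply/eqP; rewrite -subr_eq0 -e
       /v; apply/eqP; ring.
  rewrite -[LHS]/(v (6 + _.*2) * _) -[RHS]/(v (2 + _) ^+ 2 * v (3 + _) *
    v (5 + _) - v (1 + _) * v (3 + _) * v (4 + _) ^+ 2) => e.
  rewrite -[LHS]/(v (6 + _.*2) * _) -[RHS]/(v (2 + _) ^+ 2 * v (3 + _) *
    v (5 + _) - v (1 + _) * v (3 + _) * v (4 + _) ^+ 2) vS2 -!mulrA e !vS; ring.
Qed.

Lemma numer_y_qseq n : numer_y E n = h n.
Proof.
case: (cert) => _ _ a4 a6 _ _ _ _ v2 _ _ _ _ h0 h1 ho.
case: n => [|[|n]].
- by rewrite h0 /numer_y /eval_xy !hornerE.
- by rewrite h1 /numer_y /eval_xy !hornerE.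
have a23 : 2 * v 2 != 0 by rewrite v2 mulf_neq0.
apply: (mulfI a23); rewrite (numer_y_eq a4 a6 a3_neq0 origin_psi_qseq) //.
rewrite -v2; elim/period_ind: n => [i /ho|i].
  by rewrite /= !val_mulm !val_expm // => e; apply/eqP; rewrite -subr_eq0
     -oppr_eq0 -e /v /h; apply/eqP; ring.
rewrite -[RHS]/(_ * h (2 + _)) -[LHS]/(v (1 + _) ^+ 2 * v (4 + _) -
  v (0 + _) * v (3 + _) ^+ 2 - v 2 * v (2 + _) *
  (v 2 * v (2 + _) ^+ 2 - wa1 E * v (3 + _) * v (1 + _))) => e.
rewrite -[RHS]/(_ * h (2 + _)) -[LHS]/(v (1 + _) ^+ 2 * v (4 + _) -
  v (0 + _) * v (3 + _) ^+ 2 - v 2 * v (2 + _) *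
  (v 2 * v (2 + _) ^+ 2 - wa1 E * v (3 + _) * v (1 + _))) !vS hS.
rewrite (mulrCA (2 * v 2)) -e; ring.
Qed.

(** The residue modulo 2 N is recorded too, because the sign of omega_n depends
    on the parity of k. *)
Lemma numer_y_residue n : exists k r : nat,
  [/\ (r < N)%N, n = (k * N + r)%N, (n %% N)%N = r,
      (n %% (2 * N))%N = (odd k * N + r)%N &
      numer_y E n = (val_mono bs (omap (fun w => add_exp w (add_exp
        (scale_exp (r * k) (scale_exp 3 c))
        (scale_exp (k * k) (scale_exp 3 d))))
        (nth None U r)))%:~R].
Proof.
have N0 := oc_period cert; have rN : (n %% N < N)%N by rewrite ltn_mod.
exists (n %/ N)%N, (n %% N)%N; split => //; first exact: divn_eq.
  rewrite [in LHS](divn_eq n N); move: (n %/ N)%N (n %% N)%N rN => k r rN.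
  have -> : (k * N + r = k./2 * (2 * N) + (odd k * N + r))%N.
    rewrite -{1}(odd_double_half k) -muln2 mulnDl -mulnA addnA.
    by rewrite (addnC (_ * N)%N).
  by rewrite modnMDl modn_small //; case: odd; lia.
rewrite numer_y_qseq /h /Q /qseq; case: (nth _ _ _) => [w|] //=.
by rewrite monv_intr.
Qed.
End Periodic.

(** * Tables for the seven curves *)

(** The rows of the tables are the factorizations of psi_r(P) and omega_r(P),
    for r = 0, ..., N - 1, over the bases, the first of which is -1 and carries
    the sign. The multipliers are the constants C and D of the quasi-period,
    read off from psi_(N+1)(P) = C D and psi_(N+2)(P) = C^2 D psi_2(P). *)
Definition psi_table4 : seq mono :=
  [::
    None; Some [:: 0; 0]; Some [:: 1; 1]; Some [:: 1; 3]]%N.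
Definition omega_table4 : seq mono :=
  [::
    Some [:: 0; 0]; None; None; Some [:: 1; 10]]%N.
Definition multipliers4 : seq nat * seq nat :=
  ([:: 1; 3], [:: 1; 6])%N.
Definition bases4 (alpha : int) : seq int :=
  [:: -1; alpha].

Definition psi_table5 : seq mono :=
  [::
    None; Some [:: 0; 0]; Some [:: 1; 1]; Some [:: 1; 3]; Some [:: 0; 6]]%N.
Definition omega_table5 : seq mono :=
  [::
    Some [:: 0; 0]; None; Some [:: 1; 5]; None; Some [:: 0; 19]]%N.
Definition multipliers5 : seq nat * seq nat :=
  ([:: 0; 4], [:: 1; 10])%N.
Definition bases5 (alpha : int) : seq int :=
  [:: -1; alpha].

Definition psi_table6 : seq mono :=
  [::
    None; Some [:: 0; 0; 0]; Some [:: 1; 1; 1]; Some [:: 1; 3; 3];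
    Some [:: 0; 6; 5]; Some [:: 0; 10; 8]]%N.
Definition omega_table6 : seq mono :=
  [::
    Some [:: 0; 0; 0]; None; Some [:: 1; 5; 4]; Some [:: 1; 11; 9]; None;
    Some [:: 0; 31; 25]]%N.
Definition multipliers6 : seq nat * seq nat :=
  ([:: 1; 5; 4], [:: 0; 15; 12])%N.
Definition bases6 (alpha : int) : seq int :=
  [:: -1; alpha; alpha + 1].

Definition psi_table7 : seq mono :=
  [::
    None; Some [:: 0; 0; 0]; Some [:: 1; 2; 1]; Some [:: 1; 6; 3];
    Some [:: 0; 11; 6]; Some [:: 0; 17; 10]; Some [:: 1; 25; 15]]%N.
Definition omega_table7 : seq mono :=
  [::
    Some [:: 0; 0; 0]; None; Some [:: 1; 9; 5]; Some [:: 1; 19; 11];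
    Some [:: 0; 35; 20]; None; Some [:: 1; 77; 46]]%N.
Definition multipliers7 : seq nat * seq nat :=
  ([:: 0; 10; 6], [:: 0; 35; 21])%N.
Definition bases7 (alpha : int) : seq int :=
  [:: -1; alpha; alpha - 1].

Definition psi_table9 : seq mono :=
  [::
    None; Some [:: 0; 0; 0; 0]; Some [:: 1; 2; 1; 1]; Some [:: 1; 6; 3; 3];
    Some [:: 0; 12; 6; 5]; Some [:: 0; 19; 10; 8]; Some [:: 1; 27; 15; 12];
    Some [:: 1; 37; 21; 16]; Some [:: 0; 49; 28; 21]]%N.
Definition omega_table9 : seq mono :=
  [::
    Some [:: 0; 0; 0; 0]; None; Some [:: 1; 10; 5; 4]; Some [:: 1; 21; 11; 9];
    Some [:: 0; 37; 20; 17]; Some [:: 0; 59; 32; 25]; Some [:: 1; 85; 47; 36];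
    None; Some [:: 0; 149; 85; 64]]%N.
Definition multipliers9 : seq nat * seq nat :=
  ([:: 0; 14; 8; 6], [:: 1; 63; 36; 27])%N.
Definition bases9 (alpha : int) : seq int :=
  [:: -1; alpha; alpha - 1; eta alpha].

Definition psi_table10 : seq mono :=
  [::
    None; Some [:: 0; 0; 0; 0; 0]; Some [:: 1; 3; 1; 1; 4];
    Some [:: 1; 9; 3; 3; 10]; Some [:: 0; 16; 6; 6; 19];
    Some [:: 0; 25; 10; 10; 30]; Some [:: 1; 37; 15; 14; 44];
    Some [:: 1; 51; 21; 19; 60]; Some [:: 0; 66; 28; 25; 79];
    Some [:: 0; 84; 36; 32; 100]]%N.
Definition omega_table10 : seq mono :=
  [::
    Some [:: 0; 0; 0; 0; 0]; None; Some [:: 1; 13; 5; 5; 15];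
    Some [:: 1; 28; 11; 11; 34]; Some [:: 0; 52; 20; 19; 60];
    Some [:: 0; 80; 32; 30; 94]; Some [:: 1; 113; 47; 44; 135];
    Some [:: 1; 155; 65; 59; 184]; None; Some [:: 0; 255; 109; 97; 304]]%N.
Definition multipliers10 : seq nat * seq nat :=
  ([:: 1; 21; 9; 8; 25], [:: 0; 105; 45; 40; 125])%N.
Definition bases10 (alpha : int) : seq int :=
  [:: -1; alpha; alpha - 1; 2 * alpha - 1; zeta alpha].

Definition psi_table12 : seq mono :=
  [::
    None; Some [:: 0; 0; 0; 0; 0; 0]; Some [:: 1; 0; 8; 0; 1; 1];
    Some [:: 1; 0; 20; 0; 3; 3]; Some [:: 0; 0; 37; 0; 6; 5];
    Some [:: 1; 1; 60; 1; 9; 8]; Some [:: 0; 2; 86; 2; 13; 12];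
    Some [:: 1; 3; 119; 2; 18; 16]; Some [:: 0; 4; 155; 2; 24; 21];
    Some [:: 1; 6; 197; 3; 30; 27]; Some [:: 1; 8; 244; 4; 37; 33];
    Some [:: 0; 10; 295; 5; 45; 40]]%N.
Definition omega_table12 : seq mono :=
  [::
    Some [:: 0; 0; 0; 0; 0; 0]; None; Some [:: 1; 0; 29; 0; 5; 4];
    Some [:: 0; 1; 68; 1; 10; 9]; Some [:: 1; 2; 118; 2; 18; 17];
    Some [:: 0; 3; 185; 2; 29; 25]; Some [:: 1; 6; 267; 4; 41; 36];
    Some [:: 0; 10; 361; 7; 55; 50]; Some [:: 0; 14; 474; 8; 72; 64];
    Some [:: 1; 18; 597; 9; 92; 81]; None;
    Some [:: 0; 30; 893; 15; 136; 121]]%N.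
Definition multipliers12 : seq nat * seq nat :=
  ([:: 0; 2; 59; 1; 9; 8], [:: 1; 12; 354; 6; 54; 48])%N.
Definition bases12 (alpha : int) : seq int :=
  [:: -1; alpha; alpha - 1; 2 * alpha - 1; lambda alpha; theta alpha].

(** * Verification of the tables *)

Lemma consecutive_prod_even (x : int) : exists t, x * (x - 1) = 2 * t.
Proof.
have [t [->|->]] : exists t, x = 2 * t \/ x = 2 * t + 1.
- by exists (x %/ 2)%Z; lia.
- by exists (t * (2 * t - 1)); ring.
- by exists ((2 * t + 1) * t); ring.
Qed.

(** As alpha^2 - alpha is even, the values of eta, zeta, theta and of the
    factors of lambda other than alpha are odd. *)
Lemma factors_neq0 (alpha : int) : alpha != 0 -> alpha != 1 ->
  [/\ eta alpha != 0, zeta alpha != 0, lambda alpha != 0 & theta alpha != 0].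
Proof.
move=> a0 a1; have [t et] := consecutive_prod_even alpha.
rewrite /eta /zeta /lambda /theta; split; [lia | lia | | lia].
have -> : alpha - 2 * alpha ^+ 2 = alpha * (1 - 2 * alpha) by ring.
by rewrite !mulf_neq0 //; lia.
Qed.

Lemma notin_intr (xs : seq int) :
  0 \notin xs -> (0 : rat) \notin [seq x%:~R | x <- xs].
Proof.
apply: contra => /mapP[x xs_x /esym/eqP]; rewrite intr_eq0 => /eqP x0.
by rewrite -x0.
Qed.

(* Only the exponents are evaluated; the bases stay symbolic for ring. *)
Ltac eval_monos :=
  match goal with |- lin_comb _ _ ?Ms = 0 =>
    let r := eval vm_compute in Ms in
    have -> : Ms = r by vm_compute
  end.

Ltac eval_mono :=
  match goal with |- val_mono _ ?M = _ =>
    let r := eval vm_compute in M in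
    have -> : M = r by vm_compute
  end.

Ltac check_value := eval_mono; rewrite /=; ring.

Ltac check_relation :=
  eval_monos; apply: lin_comb_cancel;
  [by vm_compute | eval_monos; rewrite /=; ring].

Tactic Notation "check_relations" int_or_var(N) :=
  let i := fresh "i" in
  move=> i; do N (case: i => [_|i]; [check_relation |]); by [].

Tactic Notation "certify" integer(N) :=
  split; [ by [] | exact: monv_signed | by [] | by [] | exact: notin_intr
         | by [] | check_value | check_value | check_value | check_value
         | check_value | check_relations N | check_relations N | check_value
         | check_value | check_relations N ].

Lemma certificate4 (alpha : int) : 0 \notin bases4 alpha ->
  omega_certificate (E4 alpha) (bases4 alpha) 4 psi_table4 omega_table4
    multipliers4.1 multipliers4.2.
Proof.
rewrite /bases4 /E4 /tate => nz; certify 4.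
Qed.

Lemma certificate5 (alpha : int) : 0 \notin bases5 alpha ->
  omega_certificate (E5 alpha) (bases5 alpha) 5 psi_table5 omega_table5
    multipliers5.1 multipliers5.2.
Proof.
rewrite /bases5 /E5 /tate => nz; certify 5.
Qed.

Lemma certificate6 (alpha : int) : 0 \notin bases6 alpha ->
  omega_certificate (E6 alpha) (bases6 alpha) 6 psi_table6 omega_table6
    multipliers6.1 multipliers6.2.
Proof.
rewrite /bases6 /E6 /tate => nz; certify 6.
Qed.

Lemma certificate7 (alpha : int) : 0 \notin bases7 alpha ->
  omega_certificate (E7 alpha) (bases7 alpha) 7 psi_table7 omega_table7
    multipliers7.1 multipliers7.2.
Proof.
rewrite /bases7 /E7 /tate => nz; certify 7.
Qed.

Lemma certificate9 (alpha : int) : 0 \notin bases9 alpha ->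
  omega_certificate (E9 alpha) (bases9 alpha) 9 psi_table9 omega_table9
    multipliers9.1 multipliers9.2.
Proof.
rewrite /bases9 /E9 /tate /eta => nz; certify 9.
Qed.

Lemma certificate10 (alpha : int) : 0 \notin bases10 alpha ->
  omega_certificate (E10 alpha) (bases10 alpha) 10 psi_table10 omega_table10
    multipliers10.1 multipliers10.2.
Proof.
rewrite /bases10 /E10 /zeta /beta => nz; certify 10.
Qed.

Lemma certificate12 (alpha : int) : 0 \notin bases12 alpha ->
  omega_certificate (E12 alpha) (bases12 alpha) 12 psi_table12 omega_table12
    multipliers12.1 multipliers12.2.
Proof.
rewrite /bases12 /E12 /lambda /theta => nz; certify 12.
Qed.

(** * Closed forms *)

(** With n = k N + r and r a numeral, the entries of the exponent vector of
    omega_n are the witnesses; entry 0 is the exponent of -1. *)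
Ltac give_exponents es j :=
  match goal with
  | |- exists _, _ => exists (nth 0%N es j); give_exponents es constr:(j.+1)
  | _ => idtac
  end.

Ltac split_all :=
  match goal with
  | |- _ /\ _ => split; [| split_all]
  | |- and3 _ _ _ => split
  | |- and4 _ _ _ _ => split
  | |- and5 _ _ _ _ _ => split
  | _ => idtac
  end.

Ltac closed_form_row nk nr n2 num ok :=
  rewrite nr; split => // _;
  move: num; rewrite [omap _ _]/= => num;
  match type of num with
  | _ = (val_mono _ None)%:~R => exact: num
  | _ = (val_mono _ (Some ?es))%:~R =>
      (* for N = 6 the exponent of alpha + 1 is given outright as n ^ 2 *)
      try match goal with |- context [(?m ^ 2)%N] =>
        have -> : (m ^ 2)%N = nth 0%N es 2 by rewrite /= {1}nk; clear; lia
      end;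
      give_exponents es 1%N;
      split_all;
      match goal with
      | |- numer_y _ _ = _ =>
          rewrite num /by_residue ?nr n2; congr (_%:~R);
          rewrite [val_mono _ _]monv_left /=;
          rewrite -[(-1) ^+ _]signr_odd !(oddD, oddM) ok;
          by rewrite /= ?expr1 ?expr0
      | |- _ => by rewrite /by_residue ?nr /= {1}nk; clear; lia
      end
  end.

Tactic Notation "closed_form" integer(N) constr(spec) :=
  let k := fresh "k" in let r := fresh "r" in let rN := fresh "rN" in
  let nk := fresh "nk" in let nr := fresh "nr" in let n2 := fresh "n2" in
  let num := fresh "num" in let ok := fresh "ok" in
  have [k [r [rN nk nr n2 num]]] := spec;
  move: n2; case ok: (odd k) => n2; move: r rN nk nr n2 num;
  do N (case=> [_ nk nr n2 num|]; [closed_form_row nk nr n2 num ok |]);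
  by [].

Theorem theoremA2 (alpha : int) :
  (* N = 4 *)
  (alpha != 0 -> forall n : nat,
    ((n %% 4)%N \in [:: 1; 2]%N -> numer_y (E4 alpha) n = 0) /\
    ((n %% 4)%N \notin [:: 1; 2]%N ->
      exists e : nat,
        8 * e%:Z = 9 * n%:Z ^+ 2
          - by_residue 4 [:: ([:: 0]%N, 0); ([:: 3]%N, 1)] n /\
        numer_y (E4 alpha) n =
          (by_residue 8 [:: ([:: 0]%N, 1); ([:: 3; 4; 7]%N, -1)] n
           * alpha ^+ e)%:~R)) /\
  (* N = 5 *)
  (alpha != 0 -> forall n : nat,
    ((n %% 5)%N \in [:: 1; 3]%N -> numer_y (E5 alpha) n = 0) /\
    ((n %% 5)%N \notin [:: 1; 3]%N ->
      exists e : nat,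
        5 * e%:Z = 6 * n%:Z ^+ 2
          - by_residue 5 [:: ([:: 0]%N, 0); ([:: 2]%N, -1); ([:: 4]%N, 1)] n /\
        numer_y (E5 alpha) n =
          (by_residue 10 [:: ([:: 0; 4; 7]%N, 1); ([:: 2; 5; 9]%N, -1)] n
           * alpha ^+ e)%:~R)) /\
  (* N = 6 *)
  (alpha != -1 -> alpha != 0 -> forall n : nat,
    ((n %% 6)%N \in [:: 1; 4]%N -> numer_y (E6 alpha) n = 0) /\
    ((n %% 6)%N \notin [:: 1; 4]%N ->
      exists e : nat,
        4 * e%:Z = 5 * n%:Z ^+ 2
          - by_residue 6 [:: ([:: 0; 2]%N, 0); ([:: 3; 5]%N, 1)] n /\
        numer_y (E6 alpha) n =
          (by_residue 12 [:: ([:: 0; 5; 6; 9]%N, 1);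
                             ([:: 2; 3; 8; 11]%N, -1)] n
           * alpha ^+ e * (alpha + 1) ^+ (n ^ 2))%:~R)) /\
  (* N = 7 *)
  (alpha != 0 -> alpha != 1 -> forall n : nat,
    ((n %% 7)%N \in [:: 1; 5]%N -> numer_y (E7 alpha) n = 0) /\
    ((n %% 7)%N \notin [:: 1; 5]%N ->
      exists e1 e2 : nat,
        [/\ 7 * e1%:Z = 15 * n%:Z ^+ 2
              - by_residue 7 [:: ([:: 0]%N, 0); ([:: 2]%N, -3); ([:: 3]%N, 2);
                                 ([:: 4]%N, -5); ([:: 6]%N, 1)] n,
            7 * e2%:Z = 9 * n%:Z ^+ 2
              - by_residue 7 [:: ([:: 0]%N, 0); ([:: 2]%N, 1); ([:: 3]%N, 4);
                                 ([:: 4]%N, 4); ([:: 6]%N, 2)] n &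
            numer_y (E7 alpha) n =
              (by_residue 14 [:: ([:: 0; 4; 7; 11]%N, 1);
                                 ([:: 2; 3; 6; 9; 10; 13]%N, -1)] n
               * alpha ^+ e1 * (alpha - 1) ^+ e2)%:~R])) /\
  (* N = 9 *)
  (alpha != 0 -> alpha != 1 -> forall n : nat,
    ((n %% 9)%N \in [:: 1; 7]%N -> numer_y (E9 alpha) n = 0) /\
    ((n %% 9)%N \notin [:: 1; 7]%N ->
      exists e1 e2 e3 : nat,
        [/\ 3 * e1%:Z = 7 * n%:Z ^+ 2
              + by_residue 9 [:: ([:: 0; 3]%N, 0); ([:: 2; 5]%N, 2);
                                 ([:: 4; 8]%N, -1); ([:: 6]%N, 3)] n,
            3 * e2%:Z = 4 * n%:Z ^+ 2
              - by_residue 9 [:: ([:: 0]%N, 0); ([:: 2; 8]%N, 1);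
                                 ([:: 3; 6]%N, 3); ([:: 4; 5]%N, 4)] n,
            e3%:Z = n%:Z ^+ 2 + (if (n %% 9 == 4)%N then 1 else 0) &
            numer_y (E9 alpha) n =
              (by_residue 18 [:: ([:: 0; 4; 5; 8; 11; 12; 15]%N, 1);
                                 ([:: 2; 3; 6; 9; 13; 14; 17]%N, -1)] n
               * alpha ^+ e1 * (alpha - 1) ^+ e2 * eta alpha ^+ e3)%:~R])) /\
  (* N = 10 *)
  (alpha != 0 -> alpha != 1 -> forall n : nat,
    ((n %% 10)%N \in [:: 1; 8]%N -> numer_y (E10 alpha) n = 0) /\
    ((n %% 10)%N \notin [:: 1; 8]%N ->
      exists e1 e2 e3 e4 : nat,
        [/\ 20 * e1%:Z = 63 * n%:Z ^+ 2
              + by_residue 10 [:: ([:: 0]%N, 0); ([:: 2]%N, 8); ([:: 3]%N, -7);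
                                  ([:: 4]%N, 32); ([:: 5]%N, 25);
                                  ([:: 6]%N, -8); ([:: 7]%N, 13);
                                  ([:: 9]%N, -3)] n,
            20 * e2%:Z = 27 * n%:Z ^+ 2
              - by_residue 10 [:: ([:: 0]%N, 0); ([:: 2]%N, 8); ([:: 3]%N, 23);
                                  ([:: 4]%N, 32); ([:: 5]%N, 35);
                                  ([:: 6]%N, 32); ([:: 7]%N, 23);
                                  ([:: 9]%N, 7)] n,
            5 * e3%:Z = 6 * n%:Z ^+ 2
              + by_residue 10 [:: ([:: 0; 5]%N, 0); ([:: 2; 3; 7]%N, 1);
                                  ([:: 4; 9]%N, -1); ([:: 6]%N, 4)] n,
            4 * e4%:Z = 15 * n%:Z ^+ 2
              + (if (n %% 10)%N \in [:: 0; 2; 4; 6]%N then 0 else 1) &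
            numer_y (E10 alpha) n =
              (by_residue 20 [:: ([:: 0; 4; 5; 9; 10; 13; 14; 17]%N, 1);
                                 ([:: 2; 3; 6; 7; 12; 15; 16; 19]%N, -1)] n
               * alpha ^+ e1 * (alpha - 1) ^+ e2 * (2 * alpha - 1) ^+ e3
               * zeta alpha ^+ e4)%:~R])) /\
  (* N = 12 *)
  (alpha != 0 -> alpha != 1 -> forall n : nat,
    ((n %% 12)%N \in [:: 1; 10]%N -> numer_y (E12 alpha) n = 0) /\
    ((n %% 12)%N \notin [:: 1; 10]%N ->
      exists e1 e2 e3 e4 e5 : nat,
        4 * e1%:Z = n%:Z ^+ 2
          - by_residue 12 [:: ([:: 0]%N, 0); ([:: 2]%N, 4); ([:: 3]%N, 5);
                              ([:: 4; 8]%N, 8); ([:: 5]%N, 13); ([:: 6]%N, 12);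
                              ([:: 7; 9]%N, 9); ([:: 11]%N, 1)] n /\
        8 * e2%:Z = 59 * n%:Z ^+ 2
          + by_residue 12 [:: ([:: 0; 4]%N, 0); ([:: 2]%N, -4); ([:: 3]%N, 13);
                              ([:: 5; 11]%N, 5); ([:: 6]%N, 12);
                              ([:: 7; 9]%N, -3); ([:: 8]%N, 16)] n /\
        8 * e3%:Z = n%:Z ^+ 2
          - by_residue 12 [:: ([:: 0; 4; 8]%N, 0); ([:: 2; 6]%N, 4);
                              ([:: 3; 11]%N, 1); ([:: 5; 9]%N, 9);
                              ([:: 7]%N, -7)] n /\
        8 * e4%:Z = 9 * n%:Z ^+ 2
          - by_residue 12 [:: ([:: 0; 4; 8]%N, 0); ([:: 2; 6]%N, -4);
                              ([:: 3; 7; 11]%N, 1); ([:: 5; 9]%N, -7)] n /\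
        e5%:Z = n%:Z ^+ 2
          + (if (n %% 12)%N \in [:: 4; 7]%N then 1 else 0) /\
        numer_y (E12 alpha) n =
          (by_residue 24
             [:: ([:: 0; 3; 5; 7; 8; 11; 14; 16; 18; 21]%N, 1);
                 ([:: 2; 4; 6; 9; 12; 15; 17; 19; 20; 23]%N, -1)] n
           * alpha ^+ e1 * (alpha - 1) ^+ e2 * (2 * alpha - 1) ^+ e3
           * lambda alpha ^+ e4 * theta alpha ^+ e5)%:~R)).
Proof.
split.
  move=> a0 n.
  have nz : 0 \notin bases4 alpha by rewrite !inE; lia.
  closed_form 4 (numer_y_residue (certificate4 nz) n).
split.
  move=> a0 n.
  have nz : 0 \notin bases5 alpha by rewrite !inE; lia.
  closed_form 5 (numer_y_residue (certificate5 nz) n).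
split.
  move=> a1 a0 n.
  have nz : 0 \notin bases6 alpha by rewrite !inE; lia.
  closed_form 6 (numer_y_residue (certificate6 nz) n).
split.
  move=> a0 a1 n.
  have nz : 0 \notin bases7 alpha by rewrite !inE; lia.
  closed_form 7 (numer_y_residue (certificate7 nz) n).
split.
  move=> a0 a1 n; have [eta0 _ _ _] := factors_neq0 a0 a1.
  have nz : 0 \notin bases9 alpha by rewrite !inE; lia.
  closed_form 9 (numer_y_residue (certificate9 nz) n).
split.
  move=> a0 a1 n; have [_ zeta0 _ _] := factors_neq0 a0 a1.
  have nz : 0 \notin bases10 alpha by rewrite !inE; lia.
  closed_form 10 (numer_y_residue (certificate10 nz) n).
move=> a0 a1 n; have [_ _ lambda0 theta0] := factors_neq0 a0 a1.
have nz : 0 \notin bases12 alpha by rewrite !inE; lia.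
closed_form 12 (numer_y_residue (certificate12 nz) n).
Qed.
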